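(* For every integer $n\geq 1$, the Gromov–Hausdorff distance between the unit spheres $\mathbb{S}^1$ and $\mathbb{S}^{2n}$, each endowed with its geodesic metric, is $$d_{\mathrm{GH}}(\mathbb{S}^1,\mathbb{S}^{2n})=\frac{\pi n}{2n+1}.$$
   Context: For $k\in\mathbb{N}=\{1,2,\dots\}$, $\mathbb{S}^k=\{x\in\mathbb{R}^{k+1}:\sum_{i=1}^{k+1}x_i^2=1\}$ is endowed with the geodesic metric $d_{\mathbb{S}^k}(x,y)=\arccos(\langle x,y\rangle)\in[0,\pi]$, where $\langle\cdot,\cdot\rangle$ is the Euclidean inner product. For nonempty subsets $A,B$ of a metric space $(Z,d_Z)$, the Hausdorff distance is $d_{\mathrm{H}}^Z(A,B)=\max\left(\sup_{a\in A}d_Z(a,B),\sup_{b\in B}d_Z(b,A)\right)$, where $d_Z(a,B)=\inf_{b\in B}d_Z(a,b)$. The Gromov–Hausdorff distance $d_{\mathrm{GH}}(X,Y)$ between nonempty metric spaces $X,Y$ is the infimum of $d_{\mathrm{H}}^Z(X',Y')$ over all metric spaces $Z$ and all subspaces $X',Y'\subseteq Z$ with $X'$ isometric to $X$ and $Y'$ isometric to $Y$. *)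

(* Defs.v *)
From HB Require Import structures.
From mathcomp Require Import all_boot all_order all_algebra.
From mathcomp Require Import all_classical all_reals all_analysis.
From mathcomp Require Import ring lra.

Set Implicit Arguments.
Unset Strict Implicit.
Unset Printing Implicit Defensive.

Import Order.TTheory GRing.Theory Num.Theory.

Local Open Scope classical_set_scope.
Local Open Scope ring_scope.

Section GromovHausdorff.
Context {R : realType}.

(* All distances between sets take values in \bar R, so that no boundedness
   side condition is needed for suprema and infima to be the genuine ones. *)
Definition dist_to_set (Z : metricType R) (a : Z) (B : set Z) : \bar R :=
  ereal_inf [set (mdist a b)%:E | b in B].

Definition hausdorff_dist (Z : metricType R) (A B : set Z) : \bar R :=
  Order.max (ereal_sup [set dist_to_set a B | a in A])
            (ereal_sup [set dist_to_set b A | b in B]).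

(* [A], with the metric restricted from [Z], is isometric to [X]. *)
Definition isometric_subspace (X Z : metricType R) (A : set Z) : Prop :=
  exists f : X -> Z, set_bij [set: X] A f /\
    forall x y : X, mdist (f x) (f y) = mdist x y.

Definition gromov_hausdorff (X Y : metricType R) : \bar R :=
  ereal_inf [set r | exists (Z : metricType R) (A B : set Z),
    [/\ isometric_subspace X A, isometric_subspace Y B
      & r = hausdorff_dist A B]].

End GromovHausdorff.

Section InnerProduct.
Context {R : realType} {m : nat}.
Implicit Types x y z : 'rV[R]_m.

Definition inner x y : R := \sum_(i < m) x 0 i * y 0 i.

Lemma innerC x y : inner x y = inner y x.
Proof. by apply: eq_bigr => i _; rewrite mulrC. Qed.

Lemma innerDl x y z : inner (x + y) z = inner x z + inner y z.
Proof. by rewrite -big_split; apply: eq_bigr => i _; rewrite mxE mulrDl. Qed.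

Lemma innerZl a x z : inner (a *: x) z = a * inner x z.
Proof. by rewrite mulr_sumr; apply: eq_bigr => i _; rewrite mxE mulrA. Qed.

Lemma inner_comb a b x y : inner (a *: x + b *: y) (a *: x + b *: y) =
  a ^+ 2 * inner x x + 2 * a * b * inner x y + b ^+ 2 * inner y y.
Proof.
rewrite innerDl !innerZl !(innerC _ (_ + _)) !innerDl !innerZl (innerC y x).
ring.
Qed.

Lemma inner_ge0 x : 0 <= inner x x.
Proof. by apply: sumr_ge0 => i _; rewrite -expr2 sqr_ge0. Qed.

Lemma inner_eq0 x : inner x x = 0 -> x = 0.
Proof.
move=> /eqP; rewrite psumr_eq0 => [|i _]; last by rewrite -expr2 sqr_ge0.
move=> /allP x0; apply/rowP => i; rewrite mxE.
by have := x0 i (mem_index_enum i); rewrite /= mulf_eq0 orbb => /eqP.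
Qed.

Lemma inner_CS x y : inner x y ^+ 2 <= inner x x * inner y y.
Proof.
have [y0|yN0] := eqVneq (inner y y) 0.
  have -> : inner x y = 0.
    by rewrite (inner_eq0 y0) innerC -(scale0r (0 : 'rV[R]_m)) innerZl mul0r.
  by rewrite y0 mulr0 expr0n.
have y_gt0 : 0 < inner y y by rewrite lt_def yN0 inner_ge0.
have := inner_ge0 (inner y y *: x + (- inner x y) *: y).
rewrite inner_comb.
have -> : inner y y ^+ 2 * inner x x + 2 * inner y y * - inner x y * inner x y
   + (- inner x y) ^+ 2 * inner y y
  = inner y y * (inner x x * inner y y - inner x y ^+ 2) by ring.
by rewrite pmulr_rge0// subr_ge0.
Qed.

End InnerProduct.

(* [sphere R k] is the k-dimensional unit sphere of R^(k+1). *)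
Record sphere (R : realType) (k : nat) := Sphere {
  sphere_val :> 'rV[R]_k.+1 ;
  sphereP : \sum_(i < k.+1) sphere_val 0 i ^+ 2 == 1 }.

HB.instance Definition _ (R : realType) (k : nat) :=
  [isSub for @sphere_val R k].
HB.instance Definition _ (R : realType) (k : nat) :=
  [Choice of sphere R k by <:].

Section SphereMetric.
Context {R : realType} {k : nat}.
Implicit Types x y z : sphere R k.

Definition sphere_dist x y : R := acos (inner x y).

Lemma sphere_inner1 x : inner x x = 1.
Proof.
rewrite -(eqP (sphereP x)).
by apply: eq_bigr => i _; rewrite expr2.
Qed.

Lemma sphere_inner_bound x y : -1 <= inner x y <= 1.
Proof.
rewrite -ler_norml -(@ler_pXn2r _ 2)// ?nnegrE// real_normK ?num_real//.
by rewrite (le_trans (inner_CS _ _))// !sphere_inner1 mulr1 expr1n.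
Qed.

Lemma sphere_distxx x : sphere_dist x x = 0.
Proof. by rewrite /sphere_dist sphere_inner1 acos1. Qed.

Lemma sphere_dist_sym x y : sphere_dist x y = sphere_dist y x.
Proof. by rewrite /sphere_dist innerC. Qed.

Lemma sphere_dist_eq0 x y : sphere_dist x y = 0 -> x = y.
Proof.
move=> d0; have xy1 : inner x y = 1.
  by rewrite -(@acosK R (inner x y)) ?in_itv ?sphere_inner_bound//=
    -/(sphere_dist x y) d0 cos0.
apply: val_inj => /=; apply/eqP; rewrite -subr_eq0; apply/eqP/inner_eq0.
have -> : sphere_val x - sphere_val y = 1 *: sphere_val x + (-1) *: sphere_val y.
  by rewrite scale1r scaleN1r.
by rewrite inner_comb !sphere_inner1 xy1; ring.
Qed.

Lemma sphere_dist_triangle y x z :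
  sphere_dist x z <= sphere_dist x y + sphere_dist y z.
Proof.
have xzB := sphere_inner_bound x z.
have [/andP[a0 api] ca] := acos_def (sphere_inner_bound x y).
have [/andP[b0 bpi] cb] := acos_def (sphere_inner_bound y z).
have [/andP[c0 cpi] cc] := acos_def xzB.
rewrite -!/(sphere_dist _ _) in a0 api ca b0 bpi cb c0 cpi cc *.
set a := sphere_dist x y in a0 api ca *.
set b := sphere_dist y z in b0 bpi cb *.
set c := sphere_dist x z in c0 cpi cc *.
have [abpi|abpi] := lerP (pi : R) (a + b); first exact: le_trans abpi.
rewrite leNgt -ltr_cos ?in_itv/= ?c0 ?cpi ?addr_ge0 ?(ltW abpi)// -leNgt.
rewrite cosD cc ca cb.
have sa : 0 <= sin a by rewrite sin_ge0_pi// a0.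
have sb : 0 <= sin b by rewrite sin_ge0_pi// b0.
have sa2 : sin a ^+ 2 = 1 - inner x y ^+ 2 by rewrite sin2cos2 ca.
have sb2 : sin b ^+ 2 = 1 - inner y z ^+ 2 by rewrite sin2cos2 cb.
have CS := inner_CS (1 *: sphere_val x + (- inner x y) *: sphere_val y)
                    (1 *: sphere_val z + (- inner y z) *: sphere_val y).
have E : inner (1 *: sphere_val x + (- inner x y) *: sphere_val y)
               (1 *: sphere_val z + (- inner y z) *: sphere_val y)
    = inner x z - inner x y * inner y z.
  rewrite innerDl !innerZl !(innerC _ (_ + _)) !innerDl !innerZl.
  rewrite sphere_inner1 (innerC z x) (innerC z y) (innerC y x); ring.
rewrite E !inner_comb !sphere_inner1 (innerC z y) in CS.
have {}CS : (inner x z - inner x y * inner y z) ^+ 2 <= (sin a * sin b) ^+ 2.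
  rewrite exprMn sa2 sb2; apply: le_trans CS _.
  by rewrite le_eqVlt; apply/orP; left; apply/eqP; ring.
have sab : 0 <= sin a * sin b by rewrite mulr_ge0.
have := CS; rewrite -(real_normK (num_real (inner x z - _))).
rewrite ler_pXn2r// ?nnegrE// => /ler_normlP[h _].
lra.
Qed.

End SphereMetric.

HB.instance Definition _ (R : realType) (k : nat) :=
  @isMetric.Build R (sphere R k) (@sphere_dist R k) (@sphere_distxx R k)
    (@sphere_dist_eq0 R k) (@sphere_dist_sym R k) (@sphere_dist_triangle R k).

Lemma mdist_sphereE (R : realType) (k : nat) (x y : sphere R k) :
  mdist x y = acos (\sum_(i < k.+1) sphere_val x 0 i * sphere_val y 0 i).
Proof. by []. Qed.

(* Main.v *)
(** Lower bound.  A map from [S^(2n)] to [S^1] can be made odd without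
    increasing its distortion.  Write each point of the circle as [cos t, sin t]
    or its antipode with [t] in [[0, pi]]: this labels [S^(2n)] by an even real
    key and an odd sign.  Ky Fan's lemma on iterated barycentric subdivisions
    of the cross-polytope yields [2n + 1] arbitrarily close points whose signs
    alternate when they are sorted by key.  The distances between cyclically
    consecutive images add up to [2 n pi], so one of them is at least
    [2 n pi / (2n + 1)], and so is the distortion.

    Ky Fan's lemma is proved with cochains modulo 2: the coboundary of the
    indicator of positive alternation is the indicator of alternation of either
    sign, and the boundary of an upper hemisphere is the sum of the two
    hemispheres of the next lower dimension.

    Upper bound.  With [m = 2n + 1], cut the half sphere [x_1 + ... + x_m >= 0]
    into the [m] cells where the [i]-th coordinate is maximal.  These have
    diameter at most [pi - pi / m], which is also the diameter of the regular
    [m]-gon.  Send the [i]-th cell to the [i]-th vertex, let the centre of the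
    cell cover the arc of length [pi / m] around that vertex, and extend this
    correspondence antipodally: its distortion is at most [pi - pi / m]. *)

From HB Require Import structures.
Require Import Defs.
From mathcomp Require Import all_boot all_order all_algebra.
From mathcomp Require Import all_classical all_reals all_analysis.
From mathcomp Require Import ring lra zify.

Set Implicit Arguments.
Unset Strict Implicit.
Unset Printing Implicit Defensive.

Import Order.TTheory GRing.Theory Num.Theory numFieldNormedType.Exports.
Local Open Scope ring_scope.

(** * Ky Fan's lemma *)

Section Coboundary.
Context {T : Type}.
Implicit Types (A B : seq T -> bool) (s w : seq T).

(** The simplicial coboundary over the field of two elements: simplices are sequences, cochains are
    Boolean predicates, and no orientation signs arise. *)
Fixpoint cobound A s : bool :=
  if s is x :: s' then A s' (+) cobound (fun w => A (x :: w)) s' else false.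

Lemma eq_cobound A B s : (forall w, (size w).+1 = size s -> A w = B w) ->
  cobound A s = cobound B s.
Proof.
elim: s A B => [//|x s IHs] A B AB /=; congr (_ (+) _); first exact: AB.
by apply: IHs => w sw; apply: AB => /=; rewrite sw.
Qed.

Lemma cobound_add A B s :
  cobound (fun w => A w (+) B w) s = cobound A s (+) cobound B s.
Proof.
elim: s A B => [//|x s IHs] A B /=; rewrite IHs.
by rewrite -!addbA; congr (_ (+) _); rewrite addbCA.
Qed.

Lemma cobound_cobound A s : cobound (cobound A) s = false.
Proof.
elim: s A => [//|x s IHs] A /=.
by rewrite cobound_add IHs addbF addbb.
Qed.

Lemma cobound_andl c A s : cobound (fun w => c && A w) s = c && cobound A s.
Proof.
by elim: s A => [|x s IHs] A /=; rewrite ?andbF// IHs andb_addr.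
Qed.

End Coboundary.

Lemma cobound_map {T U : Type} (f : T -> U) (A : seq U -> bool) s :
  cobound A (map f s) = cobound (fun w => A (map f w)) s.
Proof. by elim: s A => [//|x s IHs] A /=; rewrite IHs. Qed.

Lemma cobound_witness {T : eqType} (A : seq T -> bool) s : cobound A s ->
  exists w, [/\ A w, (size w).+1 = size s & subseq w s].
Proof.
elim: s A => [//|x s IHs] A /=; case As: (A s) => /=.
  by exists s; split => //; exact: subseq_cons.
case/IHs => w [Aw sw ws]; exists (x :: w).
by split; rewrite //= ?sw// eqxx.
Qed.

(** * Barycentric subdivision and the octahedral sphere *)

Section Subdivision.
Context {T : Type} (b : seq T -> T) (neg : T -> T).
Hypothesis b_neg : forall s, b (map neg s) = neg (b s).
Implicit Types (A B : seq T -> bool) (s w : seq T).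

(** Pullback of a cochain along barycentric subdivision. For [s] of size [k] it sums [A] over the
    full flags of faces of [s], each listed by barycentres from the largest face down. *)
Fixpoint sd k A s : bool :=
  if k is k'.+1 then cobound (sd k' (fun u => A (b s :: u))) s else A s.

Lemma sd_add k A B s :
  sd k (fun w => A w (+) B w) s = sd k A s (+) sd k B s.
Proof.
elim: k A B s => [//|k IHk] A B s /=; rewrite -cobound_add.
by apply: eq_cobound => w _; exact: IHk.
Qed.

(** The faces that keep the vertex [b s] are interior and cancel in pairs, by [cobound_cobound];
    only the subdivided facets of [s] remain. *)
Lemma sd_cobound k A s : size s = k.+1 ->
  sd k.+1 (cobound A) s = cobound (sd k A) s.
Proof.
elim: k A s => [|k IHk] A s sk; rewrite [LHS]/=.
  by apply: eq_cobound => w; rewrite sk => -[/size0nil ->] /=; rewrite addbF.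
pose C := sd k.+1 (cobound (fun u => A (b s :: u))).
transitivity (cobound (fun w => sd k.+1 A w (+) C w) s).
  by apply: eq_cobound => w _; rewrite -sd_add.
rewrite cobound_add -[RHS]addbF; congr (_ (+) _).
rewrite -(cobound_cobound (sd k (fun u => A (b s :: u))) s).
by apply: eq_cobound => w; rewrite sk => -[sw]; rewrite -IHk.
Qed.

Lemma sd_neg k A s :
  sd k A (map neg s) = sd k (fun w => A (map neg w)) s.
Proof.
elim: k A s => [//|k IHk] A s /=; rewrite cobound_map.
by apply: eq_cobound => w _; rewrite IHk b_neg.
Qed.

Lemma eq_sd k A B s : size s = k -> (forall w, size w = k -> A w = B w) ->
  sd k A s = sd k B s.
Proof.
elim: k A B s => [|k IHk] A B s sk AB /=; first exact: AB.
apply: eq_cobound => w; rewrite sk => -[wk]; apply: IHk => // u uk.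
by apply: AB; rewrite /= uk.
Qed.

Definition sdn t k A := iter t (sd k) A.

Lemma eq_sdn t k A B s : size s = k -> (forall w, size w = k -> A w = B w) ->
  sdn t k A s = sdn t k B s.
Proof.
move=> + AB; elim: t s => [|t IHt] s sk /=; first exact: AB.
exact: eq_sd.
Qed.

Lemma sdn_add t k A B s : size s = k ->
  sdn t k (fun w => A w (+) B w) s = sdn t k A s (+) sdn t k B s.
Proof.
by elim: t s => [//|t IHt] s sk /=; rewrite -sd_add; exact: eq_sd.
Qed.

Lemma sdn_cobound t k A s : size s = k.+1 ->
  sdn t k.+1 (cobound A) s = cobound (sdn t k A) s.
Proof.
elim: t s => [//|t IHt] s sk; rewrite [RHS]/= -sd_cobound//.
exact: eq_sd.
Qed.

Lemma sdn_neg t k A s : size s = k ->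
  sdn t k A (map neg s) = sdn t k (fun w => A (map neg w)) s.
Proof.
by elim: t s => [//|t IHt] s sk; rewrite [LHS]/= sd_neg; exact: eq_sd.
Qed.

Lemma sdn0 t A : sdn t 0 A [::] = A [::].
Proof. by elim: t. Qed.

Variable e : nat -> T.

(** Evaluation of a cochain on the fundamental cycle of the octahedral sphere with [2 ^ k]
    facets. *)
Fixpoint octa k A : bool :=
  if k is k'.+1 then octa k' (fun u => A (e k' :: u)) (+)
                     octa k' (fun u => A (neg (e k') :: u))
  else A [::].

Lemma eq_octa k A B : (forall w, size w = k -> A w = B w) ->
  octa k A = octa k B.
Proof.
elim: k A B => [|k IHk] A B AB /=; first exact: AB.
by congr (_ (+) _); apply: IHk => w wk; apply: AB; rewrite /= wk.
Qed.

Lemma octa_add k A B : octa k (fun w => A w (+) B w) = octa k A (+) octa k B.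
Proof. by elim: k A B => [//|k IHk] A B /=; rewrite !IHk addbACA. Qed.

Lemma octa_cobound k A : octa k (cobound A) = false.
Proof.
elim: k A => [//|k IHk] A /=.
by rewrite !octa_add !IHk !addbF addbb.
Qed.

Hypothesis negK : involutive neg.

Lemma octa_neg k A : octa k (fun w => A (map neg w)) = octa k A.
Proof.
elim: k A => [//|k IHk] A /=.
rewrite (IHk (fun u => A (neg (e k) :: u))) negK.
by rewrite (IHk (fun u => A (e k :: u))) addbC.
Qed.

End Subdivision.

(** * Simplices of the subdivision and the combinatorial Ky Fan lemma *)

Section SubdivisionWitness.
Context {T : eqType} (b : seq T -> T) (neg : T -> T) (e : nat -> T).
Implicit Types (A B : seq T -> bool) (s w : seq T).

Fixpoint in_sd k s w : Prop :=
  if k is k'.+1 then exists u v, [/\ subseq u s, (size u).+1 = size s,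
    in_sd k' u v & w = b s :: v]
  else w = s.

Lemma sd_witness k A s : size s = k -> sd b k A s ->
  exists w, [/\ in_sd k s w, size w = k & A w].
Proof.
elim: k A s => [|k IHk] A s sk /=; first by exists s.
case/cobound_witness => u [+ us usub]; move: (us); rewrite sk => -[uk].
move=> /(IHk _ _ uk)[v [uv vk Av]].
exists (b s :: v); split => //=; last by rewrite vk.
by exists u, v; split; rewrite ?uk.
Qed.

Fixpoint in_sdn t k s w : Prop :=
  if t is t'.+1 then exists2 u, in_sd k s u & in_sdn t' k u w else w = s.

Lemma sdn_witness t k A s : size s = k -> sdn b t k A s ->
  exists w, [/\ in_sdn t k s w, size w = k & A w].
Proof.
elim: t s => [|t IHt] s sk /=; first by exists s.
move=> /(sd_witness sk)[u [su uk /(IHt _ uk)[w [uw wk Aw]]]].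
by exists w; split => //; exists u.
Qed.

Definition octa_simplex k s := exists eps : nat -> bool,
  forall x, x \in s ->
    exists2 i, (i < k)%N & x = if eps i then neg (e i) else e i.

Lemma octa_simplex_cons k s c : octa_simplex k s ->
  octa_simplex k.+1 ((if c then neg (e k) else e k) :: s).
Proof.
move=> [eps epsP]; exists (fun i => if (i < k)%N then eps i else c) => x.
rewrite in_cons => /orP[/eqP ->|/epsP[i ik ->]]; first by exists k; rewrite ?ltnn.
by exists i; rewrite ?ik// (ltn_trans ik).
Qed.

Lemma octa_witness k A : octa neg e k A ->
  exists s, [/\ octa_simplex k s, size s = k & A s].
Proof.
elim: k A => [|k IHk] A /=; first by exists [::]; split => //; exists xpred0.
have h c : octa neg e k (fun u => A ((if c then neg (e k) else e k) :: u)) ->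
    exists s, [/\ octa_simplex k.+1 s, size s = k.+1 & A s].
  move=> /IHk[s [ks sk As]]; exists ((if c then neg (e k) else e k) :: s).
  by split; rewrite //= ?sk//; exact: octa_simplex_cons.
case E: (octa neg e k _) => /=; last exact: (h true).
by move=> _; apply: (h false).
Qed.

Hypothesis b_neg : forall s, b (map neg s) = neg (b s).
Hypothesis negK : involutive neg.

(* Ky Fan's lemma: evaluating [cobound A = A (+) B] on the upper hemisphere of
   the octahedral sphere shows that the parity of the number of simplices
   satisfying [A] does not depend on the dimension. *)
Lemma ky_fan t k A B : A [::] -> (forall s, cobound A s = A s (+) B s) ->
  (forall j s w, (j <= k)%N -> octa_simplex j s -> size s = j ->
    in_sdn t j s w -> A (map neg w) = B w) ->
  exists s w,
    [/\ octa_simplex k s, size s = k, in_sdn t k s w, size w = k & A w].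
Proof.
move=> A0 dA AB; suff: octa neg e k (sdn b t k A).
  case/octa_witness => s [ks sk /(sdn_witness sk)[w [sw wk Aw]]].
  by exists s, w.
elim: k AB => [|k IHk] AB; first by rewrite /= sdn0.
(* The antipodal map folds the lower hemisphere onto the upper one, so the sum runs over the cones
   [e k :: w]. *)
rewrite [octa _ _ _ _]/= -[X in _ (+) X](octa_neg _ negK) -octa_add.
pose nA w := A (map neg w).
(* Modulo 2, [A] plus [nA] is the coboundary of [A] plus [nA (+) B]; the last sum vanishes on the
   subdivision by the antipodality hypothesis. *)
rewrite (@eq_octa _ _ _ _ _ (fun w => cobound (sdn b t k A) (e k :: w)
  (+) sdn b t k.+1 (fun w => nA w (+) B w) (e k :: w))); last first.
  move=> w wk; have ewk : size (e k :: w) = k.+1 by rewrite /= wk.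
  rewrite -[neg (e k) :: _]/(map neg (e k :: w)) sdn_neg// -/nA -sdn_cobound//.
  rewrite -!sdn_add//; apply: eq_sdn => // v _; rewrite dA.
  by case: (A v) (B v) (nA v) => -[] [].
rewrite octa_add.
have -> : octa neg e k (fun w => sdn b t k.+1 (fun v => nA v (+) B v) (e k :: w))
   = false.
  apply/negP => /octa_witness[s [ks sk]].
  have esk : size (e k :: s) = k.+1 by rewrite /= sk.
  move=> /(sdn_witness esk)[w [sw wk]].
  rewrite /nA (AB k.+1 (e k :: s)) ?addbb//.
  exact: (octa_simplex_cons false ks).
(* The bases of the cones give the sum over the sphere one dimension lower; their other facets
   contribute zero, since that sphere is a cycle. *)
rewrite addbF /= octa_add octa_cobound addbF; apply: IHk => j s w jk.
by apply: AB; exact: leqW.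
Qed.

End SubdivisionWitness.

(** * Alternating words and stable sorting *)

Section Alternation.

Fixpoint alternates c s : bool :=
  if s is x :: s' then (x == c) && alternates (~~ c) s' else true.

(** An alternating word has exactly one deletion that alternates from [c], at one of its ends. In
    any other word, such deletions occur only for a single pair of equal neighbours, and removing
    either of the two gives the same word, so they cancel. *)
Lemma cobound_alternates c s :
  cobound (alternates c) s = alternates true s (+) alternates false s.
Proof.
elim: s c => [//|x s IHs] c /=; rewrite cobound_andl IHs.
by case: x c => -[]; case: (alternates true s) (alternates false s) => -[].
Qed.

Context {d : Order.disp_t} {K : porderType d} {T : eqType} (key : T -> K).

(** Placing an entry before those of equal key makes the sort stable, so that deleting an entry
    commutes with sorting even when keys coincide. *)
Fixpoint insert x s := if s is y :: s' then
  if (key x <= key y)%O then x :: s else y :: insert x s' else [:: x].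

Definition isort := foldr insert [::].

Lemma perm_insert x s : perm_eq (insert x s) (x :: s).
Proof.
elim: s => [//|y s IHs] /=; case: ifP => // _.
rewrite -(perm_cons y) in IHs; apply: (perm_trans IHs).
by apply/permP => a /=; rewrite addnCA.
Qed.

Lemma perm_isort s : perm_eq (isort s) s.
Proof.
elim: s => [//|x s IHs] /=; apply: (perm_trans (perm_insert _ _)).
by rewrite perm_cons.
Qed.

End Alternation.

Section InsertionSort.
Context {d : Order.disp_t} {K : orderType d} {T : eqType} (key : T -> K).
Implicit Types s : seq T.

Let le x y := (key x <= key y)%O.

Lemma insert_path x z s : le z x -> path le z s -> path le z (insert key x s).
Proof.
elim: s z => [|y s IHs] z zx /=; first by rewrite zx.
case/andP => zy ys; case: ifP => xy /=; first by rewrite zx /le xy.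
by rewrite zy IHs// /le leNgt; apply/negP => /ltW; rewrite xy.
Qed.

Lemma insert_sorted x s : sorted le s -> sorted le (insert key x s).
Proof.
case: s => [//|y s] /= ys; case: ifP => xy /=; first by rewrite /le xy.
by apply: insert_path => //; rewrite /le leNgt; apply/negP => /ltW; rewrite xy.
Qed.

Lemma isort_sorted s : sorted le (isort key s).
Proof. by elim: s => [//|x s IHs] /=; exact: insert_sorted. Qed.

Lemma insert_min x s : all (le x) s -> insert key x s = x :: s.
Proof. by case: s => [//|y s] /= /andP[]; rewrite /le => ->. Qed.

Lemma cobound_insert A x s : sorted le s ->
  cobound A (insert key x s) = A s (+) cobound (fun w => A (insert key x w)) s.
Proof.
have le_tr : transitive le by move=> y z t; exact: le_trans.
elim: s A => [//|y s IHs] A ys /=; case: ifP => xy /=.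
  have xs : all (le x) s.
    have /allP ys' := order_path_min le_tr ys.
    by apply/allP => z /ys'; apply: le_trans.
  by rewrite insert_min.
by rewrite IHs ?(path_sorted ys)// addbCA.
Qed.

Lemma cobound_isort A s : cobound (fun w => A (isort key w)) s =
  cobound A (isort key s).
Proof.
elim: s A => [//|x s IHs] A /=.
by rewrite cobound_insert ?isort_sorted// -(IHs (fun w => A (insert key x w))).
Qed.

End InsertionSort.

(** * Shrinking of simplices under subdivision, one affine coordinate at a time *)

Section Mesh.
Context {R : realType} {T : eqType} (b : seq T -> T) (c : T -> R).
Hypothesis cb : forall s, c (b s) = (size s)%:R^-1 * \sum_(x <- s) c x.

Lemma mean_sub s a : (0 < size s)%N ->
  c (b s) - a = (size s)%:R^-1 * \sum_(x <- s) (c x - a).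
Proof.
move=> s0; rewrite sumrB cb mulrBr; congr (_ - _).
rewrite big_const_seq count_predT iter_addr addr0 mulrnAr -mulrnAl -mulr_natr.
by rewrite mulVf ?mul1r// pnatr_eq0 -lt0n.
Qed.

Lemma mean_dist s a r : (0 < size s)%N ->
  (forall x, x \in s -> `|c x - a| <= r) -> `|c (b s) - a| <= r.
Proof.
move=> s0 sr; rewrite mean_sub// normrM ger0_norm ?invr_ge0//.
rewrite mulrC ler_pdivrMr ?ltr0n//; apply: le_trans (ler_norm_sum _ _ _) _.
rewrite big_seq; apply: le_trans (ler_sum _ sr) _.
rewrite -big_seq big_const_seq count_predT iter_addr addr0.
by rewrite mulr_natr.
Qed.

(** The entry [y] contributes zero to the mean of the differences, which leaves one term fewer than
    [size s]. *)
Lemma mean_dist_vertex s y D : y \in s ->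
  (forall x, x \in s -> `|c x - c y| <= D) ->
  `|c (b s) - c y| <= (1 - (size s)%:R^-1) * D.
Proof.
move=> ys sD; have s0 : (0 < size s)%N by case: s ys {sD}.
rewrite mean_sub// (big_rem y)//= subrr add0r normrM ger0_norm ?invr_ge0//.
rewrite -[leLHS]mulrC ler_pdivrMr ?ltr0n//.
have -> : (1 - (size s)%:R^-1) * D * (size s)%:R = (size (rem y s))%:R * D.
  rewrite size_rem// -subn1 natrB//.
  by field; rewrite pnatr_eq0 -lt0n.
apply: le_trans (ler_norm_sum _ _ _) _.
rewrite big_seq (le_trans (y := \sum_(i <- rem y s | i \in rem y s) D))//.
  by apply: ler_sum => x /mem_rem; exact: sD.
rewrite -big_seq big_const_seq count_predT iter_addr addr0.
by rewrite mulr_natl.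
Qed.

Lemma in_sd_dist k s w a r : size s = k -> in_sd b k s w ->
  (forall x, x \in s -> `|c x - a| <= r) ->
  forall x, x \in w -> `|c x - a| <= r.
Proof.
elim: k s w => [|k IHk] s w sk /=; first by move=> ->.
move=> [u [v [us uk uv ->]]] sr x; rewrite in_cons => /orP[/eqP ->|].
  by apply: mean_dist; rewrite ?sk.
apply: (IHk u) => //; first by move: uk; rewrite sk => -[].
by move=> y /(mem_subseq us); exact: sr.
Qed.

(** Two vertices of [w] are barycentres of nested faces; by convexity the inner one may be replaced
    by a vertex of the outer face. The common bound [m] provides one contraction ratio for faces of
    all sizes. *)
Lemma in_sd_mesh m k s w D : size s = k -> (k <= m)%N -> in_sd b k s w ->
  (forall x y, x \in s -> y \in s -> `|c x - c y| <= D) ->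
  forall x y, x \in w -> y \in w -> `|c x - c y| <= (1 - m%:R^-1) * D.
Proof.
elim: k s w => [|k IHk] s w sk km /=; first by move: sk => /size0nil-> ->.
move=> [u [v [us uk uv ->]]] sD.
have {}uk : size u = k by move: uk; rewrite sk => -[].
have D0 : 0 <= D.
  case: s sk sD {us} => [//|z s] _ sD.
  by have := sD z z; rewrite subrr normr0; apply; rewrite inE eqxx.
have m0 : (0 < m)%N by apply: leq_trans km.
have r0 : 0 <= (1 - m%:R^-1) * D.
  by rewrite mulr_ge0// subr_ge0 invf_le1 ?ltr0n// ler1n.
have uD x y : x \in u -> y \in u -> `|c x - c y| <= D.
  by move=> /(mem_subseq us) xs /(mem_subseq us); exact: sD.
have bv x : x \in v -> `|c (b s) - c x| <= (1 - m%:R^-1) * D.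
  move=> xv; rewrite distrC; move: x xv; apply: in_sd_dist uv _ => // x xu.
  have xs := mem_subseq us xu.
  rewrite distrC; apply: le_trans (mean_dist_vertex xs _) _ => [y ys|].
    exact: sD.
  rewrite ler_wpM2r// lerB// lef_pV2 ?posrE ?ltr0n ?sk//.
  by rewrite ler_nat.
have vv := IHk u v uk (ltnW km) uv uD.
move=> x y; rewrite !in_cons => /orP[/eqP ->|xv] /orP[/eqP ->|yv].
- by rewrite subrr normr0.
- exact: bv.
- by rewrite distrC; exact: bv.
- exact: vv.
Qed.

Lemma in_sd_size k s w : size s = k -> in_sd b k s w -> size w = k.
Proof.
elim: k s w => [|k IHk] s w sk /=; first by move=> ->.
move=> [u [v [_ uk uv ->]]] /=; rewrite (IHk u)//.
by move: uk; rewrite sk => -[].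
Qed.

Lemma in_sdn_dist t k s w a r : size s = k -> in_sdn b t k s w ->
  (forall x, x \in s -> `|c x - a| <= r) ->
  forall x, x \in w -> `|c x - a| <= r.
Proof.
elim: t s => [|t IHt] s sk /=; first by move=> ->.
move=> [u su uw] sr; apply: IHt uw _; first exact: in_sd_size su.
exact: in_sd_dist su sr.
Qed.

Lemma in_sdn_mesh t k s w D : size s = k -> in_sdn b t k s w ->
  (forall x y, x \in s -> y \in s -> `|c x - c y| <= D) ->
  forall x y, x \in w -> y \in w -> `|c x - c y| <= (1 - k%:R^-1) ^+ t * D.
Proof.
elim: t s D => [|t IHt] s D sk /=; first by move=> ->; rewrite expr0 mul1r.
move=> [u su uw] sD; rewrite exprSr -mulrA.
apply: IHt uw _; first exact: in_sd_size su.
exact: in_sd_mesh su sD.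
Qed.

End Mesh.

(** * The antipodal map *)

Section SphereOpp.
Context {R : realType} {k : nat}.
Implicit Types x y : sphere R k.

Lemma sphere_oppP x : \sum_(i < k.+1) (- sphere_val x) 0 i ^+ 2 == 1.
Proof.
rewrite -(eqP (sphereP x)); apply/eqP/eq_bigr => i _.
by rewrite mxE sqrrN.
Qed.

Definition sphere_opp x : sphere R k := Sphere (sphere_oppP x).

Lemma sphere_oppK : involutive sphere_opp.
Proof. by move=> x; apply: val_inj; rewrite /= opprK. Qed.

Lemma innerNl (u v : 'rV[R]_k.+1) : inner (- u) v = - inner u v.
Proof. by rewrite -scaleN1r innerZl mulN1r. Qed.

Lemma mdist_oppl x y : mdist (sphere_opp x) y = pi - mdist x y.
Proof.
by rewrite /mdist /= /sphere_dist /= innerNl acosN// sphere_inner_bound.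
Qed.

Lemma mdist_oppr x y : mdist x (sphere_opp y) = pi - mdist x y.
Proof. by rewrite metric_sym mdist_oppl metric_sym. Qed.

Lemma mdist_opp x y : mdist (sphere_opp x) (sphere_opp y) = mdist x y.
Proof. by rewrite mdist_oppl mdist_oppr subKr. Qed.

Lemma sphere_neq0 x : sphere_val x != 0.
Proof.
apply/eqP => x0; have := sphere_inner1 x.
rewrite x0 -(scale0r (0 : 'rV[R]_k.+1)) innerZl mul0r => /esym/eqP.
by rewrite oner_eq0.
Qed.

Lemma sphere_opp_neq x : sphere_opp x != x.
Proof.
apply/eqP => /(congr1 (@sphere_val R k))/= /eqP; rewrite -subr_eq0 -opprD oppr_eq0.
by rewrite -mulr2n -scaler_nat scaler_eq0 pnatr_eq0 (negbTE (sphere_neq0 x)).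
Qed.

Lemma mdist_sphere_le x y (r : R) : 0 <= r <= pi ->
  (mdist x y <= r) = (cos r <= inner x y).
Proof.
move=> /andP[r0 rpi]; have xyB := sphere_inner_bound x y.
rewrite -[mdist x y]/(acos (inner x y)) leNgt [RHS]leNgt.
rewrite -{2}(@acosK R (inner x y)) ?in_itv//= ltr_cos//.
- by rewrite in_itv/= r0.
- by rewrite in_itv/= acos_ge0 ?acos_lepi.
Qed.

Lemma mdist_sphere_ge x y (r : R) : 0 <= r <= pi ->
  (r <= mdist x y) = (inner x y <= cos r).
Proof.
move=> /andP[r0 rpi]; have xyB := sphere_inner_bound x y.
rewrite -[mdist x y]/(acos (inner x y)) leNgt [RHS]leNgt.
rewrite -{2}(@acosK R (inner x y)) ?in_itv//= ltr_cos//.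
- by rewrite in_itv/= acos_ge0 ?acos_lepi.
- by rewrite in_itv/= r0.
Qed.

End SphereOpp.

(** * Radial projection to the sphere *)

Section Normalize.
Context {R : realType} {k : nat}.
Implicit Types u v : 'rV[R]_k.+1.

Lemma inner_gt0 u : u != 0 -> 0 < inner u u.
Proof.
by move=> u0; rewrite lt_def inner_ge0 andbT; apply: contra u0 => /eqP/inner_eq0 ->.
Qed.

Lemma sphere_basisP i :
  \sum_(j < k.+1) (delta_mx 0 i : 'rV[R]_k.+1) 0 j ^+ 2 == 1.
Proof.
rewrite (bigD1 i)//= big1 => [|j /negbTE ji]; rewrite mxE eqxx/=.
  by rewrite eqxx expr1n addr0.
by rewrite ji expr0n.
Qed.

Definition sphere_basis i : sphere R k := Sphere (sphere_basisP i).

(** The origin, which has no direction, is sent to the default point [sphere_basis ord0]. *)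
Definition normalize u : sphere R k :=
  insubd (sphere_basis ord0) ((Num.sqrt (inner u u))^-1 *: u).

Lemma val_normalize u : u != 0 ->
  sphere_val (normalize u) = (Num.sqrt (inner u u))^-1 *: u.
Proof.
move=> u0; rewrite -[LHS]/(val _) insubdK//.
rewrite /in_mem/=; apply/eqP; under eq_bigr do rewrite mxE exprMn expr2.
transitivity (\sum_i ((Num.sqrt (inner u u))^-1 ^+ 2) * (u 0 i * u 0 i)).
  by apply: eq_bigr => i _; ring.
rewrite -mulr_sumr -/(inner u u) exprVn sqr_sqrtr ?inner_ge0// mulVf//.
by rewrite gt_eqF// inner_gt0.
Qed.

Lemma normalizeN u : u != 0 -> normalize (- u) = sphere_opp (normalize u).
Proof.
move=> u0; apply: val_inj; rewrite /= !val_normalize ?oppr_eq0//.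
by rewrite innerNl innerC innerNl opprK scalerN.
Qed.

(** With [a] and [b] the two norms, [2 * inner u v] is at least [2 * a * b - D], because
    [(a - b) ^+ 2] is nonnegative; then divide by [2 * a * b], which is at least [2 * q]. *)
Lemma inner_normalize_ge u v q D : 0 < q -> q <= inner u u -> q <= inner v v ->
  inner (u - v) (u - v) <= D ->
  1 - D / (2 * q) <= inner (normalize u) (normalize v).
Proof.
move=> q0 qu qv uvD.
have u0 : u != 0.
  apply: contraTneq qu => ->; rewrite -ltNge.
  by rewrite -(scale0r (0 : 'rV[R]_k.+1)) innerZl mul0r.
have v0 : v != 0.
  apply: contraTneq qv => ->; rewrite -ltNge.
  by rewrite -(scale0r (0 : 'rV[R]_k.+1)) innerZl mul0r.
have := sqr_sqrtr (inner_ge0 u); have := sqr_sqrtr (inner_ge0 v).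
have -> : inner (normalize u) (normalize v) =
    inner u v / (Num.sqrt (inner u u) * Num.sqrt (inner v v)).
  rewrite !val_normalize// innerZl innerC innerZl innerC invfM; ring.
set a := Num.sqrt (inner u u); set b := Num.sqrt (inner v v) => bE aE.
have a0 : 0 < a by rewrite sqrtr_gt0 inner_gt0.
have b0 : 0 < b by rewrite sqrtr_gt0 inner_gt0.
have uvE : inner (u - v) (u - v) = a ^+ 2 - 2 * inner u v + b ^+ 2.
  have := inner_comb 1 (-1) u v; rewrite scale1r scaleN1r => ->.
  by rewrite aE bE; ring.
have qab : q <= a * b.
  rewrite -(@ler_pXn2r _ 2)// ?nnegrE ?(ltW q0) ?mulr_ge0 ?(ltW a0) ?(ltW b0)//.
  by rewrite exprMn aE bE expr2 ler_pM// ltW.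
have D0 : 0 <= D := le_trans (inner_ge0 _) uvD.
rewrite ler_pdivlMr ?mulr_gt0//.
have : D / 2 <= D * (a * b) / (2 * q).
  rewrite ler_pdivlMr ?mulr_gt0//.
  have -> : D / 2 * (2 * q) = D * q by field.
  by rewrite ler_wpM2l.
have : 0 <= (a - b) ^+ 2 by rewrite sqr_ge0.
have -> : (1 - D / (2 * q)) * (a * b) = a * b - D * (a * b) / (2 * q) by ring.
rewrite uvE in uvD; have -> : (a - b) ^+ 2 = a ^+ 2 - 2 * (a * b) + b ^+ 2 by ring.
lra.
Qed.

End Normalize.

Lemma alternates_negb c s : alternates c (map negb s) = alternates (~~ c) s.
Proof. by elim: s c => [//|x s IHs] c /=; rewrite IHs; case: x c => -[]. Qed.

Lemma isort_map {d : Order.disp_t} {K : porderType d} {T U : eqType}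
    (f : T -> U) (key : T -> K) (key' : U -> K) s :
  (forall x, key' (f x) = key x) ->
  isort key' (map f s) = map f (isort key s).
Proof.
move=> kf; elim: s => [//|x s IHs] /=; rewrite IHs.
elim: (isort key s) => [//|y u IHu] /=; rewrite !kf.
by case: ifP => _ //=; rewrite IHu.
Qed.

(** * Ky Fan's lemma on the round sphere *)

Section KyFanSphere.
Context {R : realType} {k : nat}.
Implicit Types (u v : 'rV[R]_k.+1) (s w : seq 'rV[R]_k.+1).

Definition barycenter s := (size s)%:R^-1 *: \sum_(x <- s) x.

Lemma barycenterN s : barycenter (map -%R s) = - barycenter s.
Proof. by rewrite /barycenter size_map big_map sumrN scalerN. Qed.

Lemma inner_barycenter z s :
  inner (barycenter s) z = (size s)%:R^-1 * \sum_(x <- s) inner x z.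
Proof.
rewrite innerZl; congr (_ * _); elim: s => [|x s IHs].
  by rewrite !big_nil -(scale0r (0 : 'rV[R]_k.+1)) innerZl mul0r.
by rewrite !big_cons innerDl IHs.
Qed.

Lemma coord_barycenter i s :
  barycenter s 0 i = (size s)%:R^-1 * \sum_(x <- s) x 0 i.
Proof. by rewrite mxE summxE. Qed.

Definition vertex (i : nat) : 'rV[R]_k.+1 := delta_mx 0 (inord i).

(** The sign vector is normal to a hyperplane containing the face; with Cauchy-Schwarz it keeps the
    face away from the origin. *)
Lemma octa_simplex_sign j s : (j <= k.+1)%N -> octa_simplex -%R vertex j s ->
  exists z : 'rV[R]_k.+1, inner z z = k.+1%:R /\
    forall x, x \in s -> inner x z = 1.
Proof.
move=> jk [eps epsP]; exists (\row_i (-1) ^+ eps i); split.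
  rewrite /inner; under eq_bigr do rewrite mxE -expr2 sqrr_sign.
  by rewrite sumr_const card_ord.
move=> x /epsP[i ij ->]; have ik : (i < k.+1)%N by apply: leq_trans jk.
have h : inner (vertex i) (\row_i (-1) ^+ eps i) = (-1) ^+ eps i.
  rewrite /inner (bigD1 (inord i))//= big1 ?addr0 => [|l /negbTE li].
    by rewrite !mxE !eqxx mul1r inordK.
  by rewrite !mxE li mul0r.
case: (eps i) h => h; last by rewrite h.
by rewrite innerNl h opprK.
Qed.

Lemma octa_simplex_coord j s i : octa_simplex -%R vertex j s ->
  forall x y, x \in s -> y \in s -> `|x 0 i - y 0 i| <= 2.
Proof.
move=> [eps epsP].
suff h x : x \in s -> `|x 0 i| <= 1.
  move=> x y /h xs /h ys; apply: le_trans (ler_normB _ _) _; lra.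
move=> /epsP[l _ ->]; case: ifP => _; rewrite ?mxE ?normrN eqxx/=;
  by case: eqP => _; rewrite ?normr1 ?normr0.
Qed.

Lemma octa_simplex_sdn t j s w : (j <= k.+1)%N -> octa_simplex -%R vertex j s ->
  size s = j -> in_sdn barycenter t j s w ->
  (forall x, x \in w -> k.+1%:R^-1 <= inner x x) /\
  (forall x y, x \in w -> y \in w ->
    inner (x - y) (x - y) <= k.+1%:R * ((1 - j%:R^-1) ^+ t * 2) ^+ 2).
Proof.
move=> jk js sj sw; split.
  have [z [zz sz]] := octa_simplex_sign jk js.
  move=> x /(in_sdn_dist (inner_barycenter z) (a := 1) (r := 0) sj sw) h.
  have {}h : inner x z = 1.
    apply/eqP; rewrite -subr_eq0 -normr_le0; apply: h => y /sz ->.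
    by rewrite subrr normr0.
  by have := inner_CS x z; rewrite h zz expr1n -ler_pdivrMr ?ltr0n// div1r.
move=> x y xw yw; rewrite /inner.
apply: le_trans (_ : \sum_(i < k.+1) ((1 - j%:R^-1) ^+ t * 2) ^+ 2 <= _).
  apply: ler_sum => i _; rewrite !mxE -expr2 -[leLHS]real_normK ?num_real//.
  have h := in_sdn_mesh (coord_barycenter i) sj sw (octa_simplex_coord i js) xw yw.
  by rewrite ler_pXn2r ?nnegrE// (le_trans _ h).
by rewrite sumr_const card_ord mulr_natl.
Qed.

End KyFanSphere.

Lemma ky_fan_sphere (R : realType) (k : nat) (key : sphere R k -> R)
    (sg : sphere R k -> bool) (eps : R) :
  (forall x, key (sphere_opp x) = key x) ->
  (forall x, sg (sphere_opp x) = ~~ sg x) ->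
  0 < eps <= pi ->
  exists w : seq (sphere R k), [/\ size w = k.+1, sorted (relpre key <=%R) w,
    alternates true (map sg w) &
    forall x y, x \in w -> y \in w -> mdist x y <= eps].
Proof.
move=> keyN sgN /andP[eps0 epspi].
pose key' (u : 'rV[R]_k.+1) := key (normalize u).
pose sg' (u : 'rV[R]_k.+1) := sg (normalize u).
have key'N u : key' (- u) = key' u.
  have [->|u0] := eqVneq u 0; first by rewrite oppr0.
  by rewrite /key' normalizeN// keyN.
pose A c (w : seq 'rV[R]_k.+1) := alternates c (map sg' (isort key' w)).
have dA w : cobound (A true) w = A true w (+) A false w.
  rewrite -(cobound_alternates true) cobound_map.
  exact: (cobound_isort key' (fun w => alternates true (map sg' w))).
set q : R := 1 - k.+1%:R^-1.
have [q0 q1] : 0 <= q /\ q < 1.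
  by rewrite /q subr_ge0 invf_le1 ?ltr0n// ler1n; split => //.
(* After [t] subdivisions, squared distances are at most [k.+1%:R * (2 * q ^+ t) ^+ 2] and squared
   norms at least [k.+1%:R^-1]. The cosines of the projected distances are then at least
   [1 - 2 * k.+1%:R ^+ 2 * q ^+ (2 * t)]. *)
have eta0 : 0 < (1 - cos eps) / (2 * k.+1%:R ^+ 2).
  rewrite divr_gt0 ?mulr_gt0 ?exprn_gt0 ?ltr0n// subr_gt0 -(@cos0 R).
  by rewrite ltr_cos// in_itv/= ?lexx ?pi_ge0// ltW.
have [t qt] : exists t, q ^+ t < (1 - cos eps) / (2 * k.+1%:R ^+ 2).
  have /cvgrPdist_lt/(_ _ eta0)[t _ /(_ t (leqnn t))] :
      (q ^+ n @[n --> \oo] --> (0 : R))%classic.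
    by apply: cvg_expr; rewrite ger0_norm.
  by rewrite sub0r normrN ger0_norm ?exprn_ge0//; exists t.
have [//|//|j s w jk js sj sw|] :=
    @ky_fan _ barycenter -%R vertex (@barycenterN R k) (@opprK _) t k.+1 (A true) (A false).
  (* Antipodes share their keys, so sorting is unaffected and the sign word is negated. This
     requires every vertex to be nonzero, as [normalize] is not odd at the origin. *)
  have [wn _] := octa_simplex_sdn jk js sj sw.
  rewrite /A (isort_map (key := key') _ key'N) -map_comp.
  rewrite -[RHS](alternates_negb true) -map_comp; congr (alternates _ _).
  apply/eq_in_map => x; rewrite (perm_mem (perm_isort key' w)) => /wn xn /=.
  rewrite /sg' normalizeN//; apply: contraTneq xn => ->; rewrite -ltNge.
  by rewrite -(scale0r (0 : 'rV[R]_k.+1)) innerZl mul0r invr_gt0 ltr0n.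
move=> s [w [ks sk sw wk Aw]].
have [wn wd] := octa_simplex_sdn (leqnn _) ks sk sw.
have pw := perm_isort key' w.
exists (map normalize (isort key' w)); split.
- by rewrite size_map (perm_size pw).
- by rewrite sorted_map; exact: isort_sorted.
- by rewrite -map_comp.
move=> x y /mapP[u] + -> /mapP[v] + ->; rewrite !(perm_mem pw) => uw vw.
rewrite mdist_sphere_le ?(ltW eps0)//.
have q0' : 0 < k.+1%:R^-1 :> R by rewrite invr_gt0 ltr0n.
apply: le_trans (inner_normalize_ge q0' (wn _ uw) (wn _ vw) (wd _ _ uw vw)).
rewrite lerBrDr -lerBrDl -/q exprMn.
have E (N p : R) : N != 0 ->
    N * (p ^+ 2 * 2 ^+ 2) / (2 * N^-1) = 2 * N ^+ 2 * p ^+ 2.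
  by move=> N0; field.
rewrite E ?pnatr_eq0// mulrC -ler_pdivlMr ?mulr_gt0 ?exprn_gt0 ?ltr0n//.
apply: le_trans (ltW qt); rewrite expr2 ler_piMr ?exprn_ge0//.
by rewrite exprn_ile1// ltW.
Qed.

(** * The lower bound *)

Section CircleAngle.
Context {R : realType}.
Implicit Types p q : sphere R 1.

Let x0 p : R := sphere_val p 0 ord0.
Let x1 p : R := sphere_val p 0 ord_max.

Lemma inner_circle (u v : 'rV[R]_2) :
  inner u v = u 0 ord0 * v 0 ord0 + u 0 ord_max * v 0 ord_max.
Proof.
rewrite /inner !big_ord_recl big_ord0 addr0.
by have -> : lift ord0 ord0 = ord_max :> 'I_2 by exact: val_inj.
Qed.

Lemma circle_eq1 p : x0 p ^+ 2 + x1 p ^+ 2 = 1.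
Proof. by rewrite -(sphere_inner1 p) inner_circle !expr2. Qed.

(* Every point of the circle is [(cos t, sin t)] or its antipode for
   [t = half_angle p] in [[0, pi]], according to [upper p]. *)
Definition upper p := (0 < x1 p) || ((x1 p == 0) && (0 < x0 p)).

Definition half_angle p : R := acos (if upper p then x0 p else - x0 p).

Lemma upper_opp p : upper (sphere_opp p) = ~~ upper p.
Proof.
have := circle_eq1 p; rewrite /upper /x0 /x1 /= !mxE -/(x0 p) -/(x1 p).
rewrite oppr_gt0 oppr_eq0 oppr_gt0 negb_or negb_and -!leNgt.
case: ltgtP => //= ->; rewrite expr0n addr0 => /eqP.
by case: ltgtP => //= ->; rewrite expr0n eq_sym oner_eq0.
Qed.

Lemma half_angle_opp p : half_angle (sphere_opp p) = half_angle p.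
Proof.
by rewrite /half_angle upper_opp /x0 /= mxE -/(x0 p); case: upper; rewrite ?opprK.
Qed.

Lemma circle_x0_bound p : -1 <= x0 p <= 1.
Proof.
rewrite -ler_norml -(@ler_pXn2r _ 2)// ?nnegrE// real_normK ?num_real//.
by rewrite expr1n -(circle_eq1 p) lerDl sqr_ge0.
Qed.

Lemma half_angle_bound p : 0 <= half_angle p <= pi.
Proof.
have b := circle_x0_bound p.
rewrite /half_angle; case: upper; first by rewrite acos_ge0 ?acos_lepi.
have b' : -1 <= - x0 p <= 1 by lra.
by rewrite acos_ge0 ?acos_lepi.
Qed.

Lemma circle_half_angle p :
  x0 p = (-1) ^+ (~~ upper p) * cos (half_angle p) /\
  x1 p = (-1) ^+ (~~ upper p) * sin (half_angle p).
Proof.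
have b := circle_x0_bound p.
have b' : -1 <= - x0 p <= 1 by lra.
have x1E : 1 - x0 p ^+ 2 = x1 p ^+ 2 by rewrite -(circle_eq1 p) addrAC subrr add0r.
rewrite /half_angle; case: ifPn => up /=.
  rewrite acosK ?in_itv// sin_acos// x1E sqrtr_sqr expr0 !mul1r ger0_norm//.
  by move: up => /orP[/ltW//|/andP[/eqP ->]].
rewrite acosK ?in_itv// sin_acos// sqrrN x1E sqrtr_sqr expr1 !mulN1r opprK.
rewrite ler0_norm ?opprK// leNgt.
by apply: contra up; rewrite /upper => ->.
Qed.

Lemma mdist_half_angle p q : half_angle p <= half_angle q ->
  mdist p q = if upper p == upper q then half_angle q - half_angle p
              else pi - (half_angle q - half_angle p).
Proof.
move=> pq; have /andP[p0 _] := half_angle_bound p.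
have /andP[_ qpi] := half_angle_bound q.
have dB : 0 <= half_angle q - half_angle p <= pi by lra.
rewrite -[LHS]/(acos (inner p q)) inner_circle -/(x0 p) -/(x0 q) -/(x1 p) -/(x1 q).
have [-> ->] := circle_half_angle p; have [-> ->] := circle_half_angle q.
set s := (-1) ^+ _; set r := (-1) ^+ _.
have -> : s * cos (half_angle p) * (r * cos (half_angle q)) +
    s * sin (half_angle p) * (r * sin (half_angle q)) =
    s * r * cos (half_angle q - half_angle p) by rewrite cosB; ring.
rewrite /s /r -signr_addb; case: (upper p) (upper q) => -[] /=;
  rewrite ?expr0 ?expr1 ?mul1r ?mulN1r ?acosN ?cosK ?in_itv//;
  by rewrite cos_geN1 cos_le1.
Qed.

Let le_angle := relpre half_angle <=%R.

Lemma alternating_path c p l E : path le_angle p l ->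
  alternates c (map upper (p :: l)) ->
  (forall x y, x \in p :: l -> y \in p :: l -> mdist x y <= E) ->
  (size l)%:R * (pi - E) <= half_angle (last p l) - half_angle p /\
  upper (last p l) = c (+) odd (size l).
Proof.
elim: l c p => [|q l IHl] c p.
  by rewrite /= mul0r subrr andbT addbF => _ /eqP ->.
move=> /= /andP[pq ql] /andP[/eqP pc /andP[/eqP qc lc]] pE.
have [||qlast ->] := IHl (~~ c) q ql; first by rewrite /= qc eqxx.
  by move=> x y xl yl; apply: pE; rewrite inE ?xl ?yl orbT.
split; last by rewrite addNb addbN.
have := pE p q; rewrite !inE !eqxx orbT => /(_ isT isT).
rewrite mdist_half_angle// pc qc; case: c {pc qc lc IHl} => /= => h;
  rewrite -natr1 mulrDl mul1r; lra.
Qed.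

(* The distances between cyclically consecutive points of an alternating
   sequence of [2n + 1] points add up to [2 n pi]. *)
Lemma alternating_diameter n w E : size w = (2 * n).+1 -> sorted le_angle w ->
  alternates true (map upper w) ->
  (forall x y, x \in w -> y \in w -> mdist x y <= E) ->
  2 * n%:R * pi <= (2 * n%:R + 1) * E.
Proof.
case: w => [//|p l] [sl] pl al wE.
have [] := alternating_path pl al wE.
rewrite sl mul2n odd_double -mul2n natrM addbF => h1 h2.
(* As the number of points is odd, the first and last signs agree, and the closing distance is the
   plain difference of the extreme half angles. *)
have up : upper p by move: al => /= /andP[/eqP].
have := wE p (last p l); rewrite mem_head mem_last => /(_ isT isT).
rewrite mdist_half_angle ?up ?h2//=.
  by move: h1; set d := _ - half_angle p => h1 dE; nra.
have pE : E <= pi -> half_angle p <= half_angle (last p l).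
  move=> Epi; rewrite -subr_ge0; apply: le_trans h1.
  by rewrite mulr_ge0 ?mulr_ge0// subr_ge0.
have le_tr : transitive le_angle by move=> x y z; exact: le_trans.
have := mem_last p l; rewrite inE => /orP[/eqP ->//|].
by move: (order_path_min le_tr pl) => /allP; apply.
Qed.

End CircleAngle.

(* Selects exactly one point of each antipodal pair. *)
Definition helmet (R : realType) (k : nat) (x : sphere R k) : bool :=
  choose (pred2 x (sphere_opp x)) x == x.

(** [choose] returns the same element for equivalent predicates and any two valid seeds, so both
    points of a pair select the same representative. *)
Lemma helmet_opp (R : realType) (k : nat) (x : sphere R k) :
  helmet (sphere_opp x) = ~~ helmet x.
Proof.
rewrite /helmet; set c := choose _ x.
have -> : choose (pred2 (sphere_opp x) (sphere_opp (sphere_opp x)))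
    (sphere_opp x) = c.
  rewrite sphere_oppK /c (@choose_id _ _ x (sphere_opp x))/= ?eqxx ?orbT//.
  by apply: eq_choose => y /=; rewrite orbC.
have : c \in pred2 x (sphere_opp x) by apply: chooseP; rewrite /= eqxx.
rewrite inE => /orP[/eqP ->|/eqP ->]; rewrite eqxx.
  by rewrite eq_sym; exact/negbTE/sphere_opp_neq.
by rewrite (negbTE (sphere_opp_neq x)).
Qed.

Definition odd_extension (R : realType) (j k : nat)
    (h : sphere R j -> sphere R k) x :=
  if helmet x then h x else sphere_opp (h (sphere_opp x)).

Lemma odd_extension_opp (R : realType) (j k : nat)
    (h : sphere R j -> sphere R k) x :
  odd_extension h (sphere_opp x) = sphere_opp (odd_extension h x).
Proof.
by rewrite /odd_extension helmet_opp; case: helmet; rewrite /= ?sphere_oppK.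
Qed.

(** Replacing a point and its image by their antipodes turns each distance [d] into [pi - d], which
    only changes the sign of the difference. *)
Lemma odd_extension_distortion (R : realType) (j k : nat)
    (h : sphere R j -> sphere R k) (D : R) :
  (forall x y, `|mdist (h x) (h y) - mdist x y| <= D) ->
  forall x y, `|mdist (odd_extension h x) (odd_extension h y) - mdist x y| <= D.
Proof.
move=> hD x y; rewrite /odd_extension; case: helmet; case: helmet => //.
- have := hD x (sphere_opp y); rewrite !mdist_oppr distrC.
  by rewrite [X in `|X|](_ : _ = pi - mdist (h x) (h (sphere_opp y)) - mdist x y)//; ring.
- have := hD (sphere_opp x) y; rewrite !mdist_oppl distrC.
  by rewrite [X in `|X|](_ : _ = pi - mdist (h (sphere_opp x)) (h y) - mdist x y)//; ring.
- by have := hD (sphere_opp x) (sphere_opp y); rewrite !mdist_opp.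
Qed.

Lemma distortion_lower_bound (R : realType) (n : nat)
    (h : sphere R (2 * n) -> sphere R 1) (D : R) :
  (forall x y, `|mdist (h x) (h y) - mdist x y| <= D) ->
  2 * n%:R * pi <= (2 * n%:R + 1) * D.
Proof.
move=> /odd_extension_distortion; set f := odd_extension h => fD.
have n0 : 0 < 2 * n%:R + 1 :> R by rewrite ltr_pwDr// mulr_ge0.
(* Ky Fan's lemma gives points that are close but distinct, so the bound is proved for [D + e] with
   [e] arbitrarily small. *)
rewrite mulrC -ler_pdivrMl//; apply/ler_addgt0Pr => e e0.
rewrite ler_pdivrMl// mulrC.
have [|||w [ws wsort wa wd]] := @ky_fan_sphere R (2 * n) (fun x => half_angle (f x))
    (fun x => upper (f x)) (Num.min e pi).
- by move=> x; rewrite /f odd_extension_opp half_angle_opp.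
- by move=> x; rewrite /f odd_extension_opp upper_opp.
- by rewrite lt_min e0 pi_gt0 ge_min lexx orbT.
have wE x y : x \in map f w -> y \in map f w -> mdist x y <= D + e.
  move=> /mapP[u uw ->] /mapP[v vw ->].
  have := wd u v uw vw; rewrite le_min => /andP[uve _].
  have := fD u v; rewrite ler_norml => /andP[_]; lra.
apply: (alternating_diameter (w := map f w)) => //.
- by rewrite size_map.
- by rewrite sorted_map.
- by rewrite -map_comp.
Qed.

(** * Gromov-Hausdorff distance and correspondences *)

Section Correspondences.
Local Open Scope classical_set_scope.

(** If the Hausdorff distance were below some [s < r], sending each point of [Y] to a point of [X]
    closer than [s] would have distortion at most [2 * s]. *)
Lemma gromov_hausdorff_ge {R : realType} (X Y : metricType R) (r : R) :
  (forall (h : Y -> X) D,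
    (forall x y, `|mdist (h x) (h y) - mdist x y| <= D) -> 2 * r <= D) ->
  (r%:E <= gromov_hausdorff X Y)%E.
Proof.
move=> hD; apply: le_ereal_inf_tmp => _ [Z [A [B [[f [fA fd]] [g [gB gd]] ->]]]].
rewrite leNgt; apply/negP => Hr.
have [s sr Hs] : exists2 s, s < r & (hausdorff_dist A B < s%:E)%E.
  case: (hausdorff_dist A B) Hr => [t| |]//=.
    rewrite lte_fin => tr; exists ((t + r) / 2); first lra.
    by rewrite lte_fin; lra.
  by move=> _; exists (r - 1); rewrite ?ltNyr//; lra.
have /choice[h hP] y : exists x, mdist (g y) (f x) < s.
  have gyB : B (g y) by case: gB => gB _ _; apply: gB.
  have : (dist_to_set (g y) A < s%:E)%E.
    apply: le_lt_trans Hs; rewrite /hausdorff_dist le_max; apply/orP; right.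
    by apply: ereal_sup_ubound; exists (g y).
  move=> /ereal_inf_lt[_ [a Aa <-]]; rewrite lte_fin => gas.
  by case: fA => _ _ /(_ _ Aa)[x _ xa]; exists x; rewrite xa.
suff /(hD h) : forall x y, `|mdist (h x) (h y) - mdist x y| <= 2 * s by lra.
move=> x y; rewrite -fd -gd ler_norml.
have := hP x; have := hP y.
have := metric_triangle (f (h x)) (g x) (f (h y)).
have := metric_triangle (g x) (g y) (f (h y)).
have := metric_triangle (g x) (f (h x)) (g y).
have := metric_triangle (f (h x)) (f (h y)) (g y).
rewrite (metric_sym (f (h x)) (g x)) (metric_sym (f (h y)) (g y)).
by move=> *; apply/andP; split; lra.
Qed.

(** Positivity of [r] keeps the two copies apart in the glued space, and the inhabitant makes the
    infimum in [cross_dist] run over a nonempty set. *)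
Record correspondence {R : realType} (X Y : metricType R) (r : R) :=
  Correspondence {
  corr :> X -> Y -> Prop ;
  corr_inhabited : exists x y, corr x y ;
  corr_left : forall x, exists y, corr x y ;
  corr_right : forall y, exists x, corr x y ;
  corr_gt0 : 0 < r ;
  corr_distortion : forall x x' y y', corr x y -> corr x' y' ->
    `|mdist x x' - mdist y y'| <= 2 * r }.

(** * Gluing two spaces along a correspondence *)

Section Glue.
Context {R : realType} (X Y : metricType R) (r : R) (C : correspondence X Y r).

Let detours x y : set R :=
  [set d | exists x' y', C x' y' /\ d = mdist x x' + mdist y' y].

(** Length of a shortest path from [x] to [y] that crosses once, at cost [r], between corresponding
    points. *)
Definition cross_dist x y : R := inf (detours x y) + r.

Lemma cross_dist_le x y x' y' : C x' y' ->
  cross_dist x y <= mdist x x' + mdist y' y + r.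
Proof.
move=> Cxy; rewrite lerD2r; apply: ge_inf; last by exists x', y'.
by exists 0 => _ [a [b' [_ ->]]]; rewrite addr_ge0// mdist_ge0.
Qed.

Lemma cross_dist_ge x y z :
  (forall x' y', C x' y' -> z <= mdist x x' + mdist y' y + r) ->
  z <= cross_dist x y.
Proof.
move=> zle; rewrite -lerBlDr; apply: lb_le_inf.
  by have [a [b' ab]] := corr_inhabited C; exists (mdist x a + mdist b' y), a, b'.
by move=> _ [a [b' [/zle ab ->]]]; rewrite lerBlDr.
Qed.

Lemma cross_dist_gt0 x y : 0 < cross_dist x y.
Proof.
apply: lt_le_trans (corr_gt0 C) _; apply: cross_dist_ge => a b' _.
by rewrite lerDr addr_ge0// mdist_ge0.
Qed.

Definition glue := (X + Y)%type.

Definition glue_dist (u v : glue) : R :=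
  match u, v with
  | inl x, inl x' => mdist x x'
  | inr y, inr y' => mdist y y'
  | inl x, inr y | inr y, inl x => cross_dist x y
  end.

Lemma glue_distxx u : glue_dist u u = 0.
Proof. by case: u => z /=; rewrite mdistxx. Qed.

Lemma glue_dist_eq0 u v : glue_dist u v = 0 -> u = v.
Proof.
case: u v => [x|y] [x'|y'] /=; try by move=> /mdist_positivity ->.
- by move/eqP; rewrite gt_eqF// cross_dist_gt0.
- by move/eqP; rewrite gt_eqF// cross_dist_gt0.
Qed.

Lemma glue_dist_sym u v : glue_dist u v = glue_dist v u.
Proof. by case: u v => [x|y] [x'|y'] //=; rewrite metric_sym. Qed.

Lemma cross_dist_triangle_l x x' y :
  cross_dist x y <= mdist x x' + cross_dist x' y.
Proof.
rewrite -lerBlDl; apply: cross_dist_ge => a b' ab.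
have := cross_dist_le x y ab; have := metric_triangle x x' a; lra.
Qed.

Lemma cross_dist_triangle_r x y y' :
  cross_dist x y <= cross_dist x y' + mdist y' y.
Proof.
rewrite -lerBlDr; apply: cross_dist_ge => a b' ab.
have := cross_dist_le x y ab; have := metric_triangle b' y' y; lra.
Qed.

(** The two crossing costs [r] pay for the distortion [2 * r] between the pairs used by the two
    detours. *)
Lemma mdist_le_cross_l x x' y : mdist x x' <= cross_dist x y + cross_dist x' y.
Proof.
rewrite -lerBlDr; apply: cross_dist_ge => a c ac.
rewrite lerBlDr -lerBlDl; apply: cross_dist_ge => a' c' ac'.
have := corr_distortion ac ac'; rewrite ler_norml => /andP[_].
have := metric_triangle x a x'; have := metric_triangle a a' x'.
have := metric_triangle c y c'.
by rewrite (metric_sym a' x') (metric_sym y c'); lra.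
Qed.

Lemma mdist_le_cross_r x y y' : mdist y y' <= cross_dist x y + cross_dist x y'.
Proof.
rewrite -lerBlDr; apply: cross_dist_ge => a c ac.
rewrite lerBlDr -lerBlDl; apply: cross_dist_ge => a' c' ac'.
have := corr_distortion ac ac'; rewrite ler_norml => /andP[+ _].
have := metric_triangle y c y'; have := metric_triangle c c' y'.
have := metric_triangle a x a'.
by rewrite (metric_sym y c) (metric_sym a x); lra.
Qed.

Lemma glue_dist_triangle v u w : glue_dist u w <= glue_dist u v + glue_dist v w.
Proof.
case: u v w => [x|y] [x'|y'] [x''|y''] /=; try exact: metric_triangle.
- exact: cross_dist_triangle_l.
- exact: mdist_le_cross_l.
- exact: cross_dist_triangle_r.
- by rewrite addrC (metric_sym x'); exact: cross_dist_triangle_l.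
- exact: mdist_le_cross_r.
- by rewrite addrC (metric_sym y); exact: cross_dist_triangle_r.
Qed.

HB.instance Definition _ := Choice.copy glue (X + Y)%type.

HB.instance Definition _ := @isMetric.Build R glue glue_dist glue_distxx
  glue_dist_eq0 glue_dist_sym glue_dist_triangle.

Lemma gromov_hausdorff_le : (gromov_hausdorff X Y <= r%:E)%E.
Proof.
pose A : set glue := range inl; pose B : set glue := range inr.
apply: le_trans (_ : hausdorff_dist A B <= _)%E.
  apply: ereal_inf_lbound; exists glue, A, B; split=> //.
  - exists inl; split => //; split; [by move=> x _; exists x| by move=> x y _ _ []|].
    by move=> _ [x _ <-]; exists x.
  - exists inr; split => //; split; [by move=> x _; exists x| by move=> x y _ _ []|].
    by move=> _ [x _ <-]; exists x.
have crossr x y : C x y -> cross_dist x y <= r.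
  by move=> /(cross_dist_le x y); rewrite !mdistxx !add0r.
rewrite /hausdorff_dist ge_max; apply/andP; split.
  apply: ge_ereal_sup => _ [_ [x _ <-] <-]; have [y Cxy] := corr_left C x.
  apply: le_trans (_ : (mdist (inl x : glue) (inr y))%:E <= _)%E.
    by apply: ereal_inf_lbound; exists (inr y) => //; exists y.
  by rewrite lee_fin; exact: crossr.
apply: ge_ereal_sup => _ [_ [y _ <-] <-]; have [x Cxy] := corr_right C y.
apply: le_trans (_ : (mdist (inr y : glue) (inl x))%:E <= _)%E.
  by apply: ereal_inf_lbound; exists (inl x) => //; exists x.
by rewrite lee_fin; exact: crossr.
Qed.

End Glue.

End Correspondences.

(** * The upper bound *)

Section VoronoiCell.
Context {R : realType} {k : nat}.
Implicit Types x y : 'rV[R]_k.+1.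

(* The points of the half space [sum_j x_j >= 0] whose orthogonal projection to
   its boundary lies in the Voronoi cell of the [i]-th vertex of the regular
   simplex spanned by the projected basis vectors. *)
Definition cell i x : Prop :=
  0 <= \sum_(j < k.+1) x 0 j /\ forall j, x 0 j <= x 0 i.

Lemma sum_sqr_sub (a : R) (f : 'I_k.+1 -> R) :
  \sum_j (a - f j) ^+ 2 =
  k.+1%:R * a ^+ 2 - 2 * a * \sum_j f j + \sum_j f j ^+ 2.
Proof.
have E j : (a - f j) ^+ 2 = (a ^+ 2 - 2 * a * f j) + f j ^+ 2 by ring.
under eq_bigr do rewrite E.
by rewrite big_split sumrB /= sumr_const card_ord -[_ *+ k.+1]mulr_natl mulr_sumr.
Qed.

(** Cauchy-Schwarz against the indicator of the indices other than [i] gives the factor [k] instead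
    of [k.+1]. *)
Lemma sqr_sum_le_vanishing (f : 'I_k.+1 -> R) i : f i = 0 ->
  (\sum_j f j) ^+ 2 <= k%:R * \sum_j f j ^+ 2.
Proof.
move=> fi; have := inner_CS (\row_j f j) (\row_j (j != i)%:R).
have -> : inner (\row_j f j) (\row_j (j != i)%:R) = \sum_j f j.
  apply: eq_bigr => j _; rewrite !mxE.
  by have [->|_] := eqVneq; rewrite ?fi ?mulr0 ?mulr1.
have -> : inner (\row_j f j) (\row_j f j) = \sum_j f j ^+ 2.
  by apply: eq_bigr => j _; rewrite !mxE expr2.
have -> : inner (\row_j (j != i)%:R) (\row_j (j != i)%:R) = k%:R :> R.
  rewrite /inner (bigD1 i)//= !mxE eqxx mulr0 add0r.
  under eq_bigr => j ji do rewrite !mxE ji mulr1.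
  by rewrite sumr_const cardC1 card_ord.
by rewrite mulrC.
Qed.

(** In a cell the coordinate sum and the differences from the [i]-th coordinate are nonnegative, so
    each is at most as large in absolute value for [x - y] as for [x + y]. *)
Lemma cell_antipodal_bound i x y : cell i x -> cell i y ->
  inner (x - y) (x - y) <= k.+1%:R * inner (x + y) (x + y).
Proof.
move=> [x0 xi] [y0 yi].
pose p j : R := x 0 j + y 0 j; pose d j : R := x 0 j - y 0 j.
have -> : inner (x - y) (x - y) = \sum_j d j ^+ 2.
  by apply: eq_bigr => j _; rewrite !mxE expr2.
have -> : inner (x + y) (x + y) = \sum_j p j ^+ 2.
  by apply: eq_bigr => j _; rewrite !mxE expr2.
have pr : \sum_j (d i - d j) ^+ 2 <= \sum_j (p i - p j) ^+ 2.
  apply: ler_sum => j _; have := xi j; have := yi j; rewrite /d /p; nra.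
have := @sqr_sum_le_vanishing (fun j => p i - p j) i (subrr _).
rewrite sumrB sumr_const card_ord; move: pr; rewrite !sum_sqr_sub.
have : (\sum_j d j) ^+ 2 <= (\sum_j p j) ^+ 2.
  rewrite /d /p sumrB big_split /=; nra.
rewrite -mulr_natl -natr1; set N : R := k%:R.
have N0 : 0 <= N by rewrite /N.
set P := \sum_j p j; set D := \sum_j d j.
set p2 := \sum_j p j ^+ 2; set d2 := \sum_j d j ^+ 2.
move: (p i) (d i) => a c h1 h2 h3.
(* After multiplication by [N + 1], this square completes [h2] on the side of [x - y]; [h3] bounds
   the corresponding square for [x + y]. *)
have h4 : 0 <= ((N + 1) * c - D) ^+ 2 by rewrite sqr_ge0.
have N1 : 0 < N + 1 by rewrite ltr_wpDl.
rewrite -(ler_pM2l N1).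
have h5 : 0 <= P ^+ 2 by rewrite sqr_ge0.
have h6 : 0 <= N * P ^+ 2 by rewrite mulr_ge0.
nra.
Qed.

End VoronoiCell.

(** * Trigonometric estimates *)

Lemma sin_le_id (R : realType) (x : R) : 0 <= x -> sin x <= x.
Proof.
move=> x0; have [|c _] := @MVT_segment R sin cos 0 x x0 (fun x _ => is_derive_sin x).
  by apply: continuous_subspaceT => y; exact: continuous_sin.
by rewrite sin0 !subr0 => ->; rewrite ler_piMl// cos_le1.
Qed.

Lemma cos_double (R : realType) (x : R) : cos (2 * x) = 1 - 2 * sin x ^+ 2.
Proof. by rewrite mulr_natl cos_mulr2n cos2sin2; ring. Qed.

(** Turns the bound on inner products in a cell into the diameter bound. For [n = 1] it is an
    equality, obtained from the triple-angle formula. *)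
Lemma cos_pi_odd_ge (R : realType) (n : nat) : (1 <= n)%N ->
  n%:R / (n%:R + 1) <= cos (pi / (2 * n%:R + 1) : R).
Proof.
case: n => [//|[_|n _]].
  have -> : 2 * 1 + 1 = 3 :> R by ring.
  set c := cos _; have c3 : cos (2 * (pi / 3) + pi / 3) = -1 :> R.
    by rewrite -[RHS](@cospi R); congr cos; field.
  have cpos : 0 < c.
    by apply: cos_gt0_pihalf; have := @pi_gt0 R; lra.
  move: c3.
  rewrite cosD cos_double (mulr_natl (pi / 3) 2) sin_mulr2n -/c.
  set s := sin _; have : c ^+ 2 + s ^+ 2 = 1 by rewrite cos2Dsin2.
  move=> cs h; have : (c + 1) * (2 * c - 1) ^+ 2 = 0.
    have -> : (c + 1) * (2 * c - 1) ^+ 2 = 4 * c ^+ 3 - 3 * c + 1 by ring.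
    have s2 : s ^+ 2 = 1 - c ^+ 2 by lra.
    have E : c - 4 * c * (1 - c ^+ 2) = -1 by rewrite -s2 -h; ring.
    by rewrite (_ : _ + 1 = c - 4 * c * (1 - c ^+ 2) + 1); [rewrite E addNr|ring].
  move=> /eqP; rewrite mulf_eq0 expf_eq0/= => /orP[/eqP|/eqP]; 
    rewrite ler_pdivrMr; lra.
(* From here on the crude bounds [sin t <= t] and [pi < 4] suffice: [(2 * N + 1) ^+ 2] is at least
   [8 * (N + 1)] once [N] is at least 2. *)
set N : R := n.+2%:R; have N2 : 2 <= N by rewrite /N ler_nat.
set t := pi / (2 * (2 * N + 1)).
have -> : pi / (2 * N + 1) = 2 * t by rewrite /t; field; lra.
have pi4 : pi < 4 :> R by have := @pihalf_lt2 R; lra.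
have t0 : 0 <= t by rewrite /t divr_ge0 ?pi_ge0//; lra.
have t1 : t <= 2 / (2 * N + 1).
  rewrite /t ler_pdivrMr; last lra.
  by rewrite (_ : _ * (2 * _) = 4); [exact: ltW|field; lra].
have s1 : sin t <= 2 / (2 * N + 1) := le_trans (sin_le_id t0) t1.
have s0 : 0 <= sin t.
  apply: sin_ge0_pi; rewrite t0 /t ler_pdivrMr; last lra.
  by have := @pi_gt0 R; nra.
rewrite cos_double.
have s2 : sin t ^+ 2 <= (2 / (2 * N + 1)) ^+ 2.
  by rewrite ler_pXn2r ?nnegrE// divr_ge0//; lra.
apply: le_trans (_ : 1 - 2 * (2 / (2 * N + 1)) ^+ 2 <= _); last lra.
rewrite ler_pdivrMr; last lra.
rewrite exprMn exprVn -subr_ge0.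
have -> : (1 - 2 * (2 ^+ 2 * (2 * N + 1) ^- 2)) * (N + 1) - N =
  ((2 * N + 1) ^+ 2 - 8 * (N + 1)) / (2 * N + 1) ^+ 2 by field; lra.
by rewrite divr_ge0 ?sqr_ge0//; nra.
Qed.

(** * Distances between points of the circle given by angles *)

Section CirclePoint.
Context {R : realType}.
Implicit Types a b t : R.

Lemma circle_pointP t :
  \sum_(i < 2) (\row_(i < 2) (if i == 0 then cos t else sin t)) 0 i ^+ 2 == 1.
Proof. by rewrite !big_ord_recl big_ord0 !mxE /= addr0 cos2Dsin2. Qed.

Definition circle_point t : sphere R 1 := Sphere (circle_pointP t).

Lemma mdist_circle_point a b :
  mdist (circle_point a) (circle_point b) = acos (cos (a - b)).
Proof. by rewrite mdist_sphereE !big_ord_recl big_ord0 !mxE /= addr0 cosB. Qed.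

Lemma circle_pointDpi t : circle_point (t + pi) = sphere_opp (circle_point t).
Proof.
apply: val_inj; apply/rowP => i; rewrite !mxE.
by case: ifP => _; rewrite ?cosDpi ?sinDpi.
Qed.

Lemma circle_point_half_angle (q : sphere R 1) :
  q = if upper q then circle_point (half_angle q)
      else sphere_opp (circle_point (half_angle q)).
Proof.
have [q0 q1] := circle_half_angle q; apply: val_inj; apply/rowP => i.
have [->|->] : i = ord0 \/ i = ord_max.
  by case: i => -[|[|//]] h; [left|right]; exact: val_inj.
  by rewrite q0; case: upper; rewrite !mxE /= ?mul1r ?mulN1r.
by rewrite q1; case: upper; rewrite !mxE /= ?mul1r ?mulN1r.
Qed.

Lemma acos_cos_reflect a : pi <= a <= 2 * pi -> acos (cos a) = 2 * pi - a.
Proof.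
move=> /andP[api a2].
have -> : cos a = cos (a - 2 * pi).
  by rewrite -[RHS](@cosD2pi R) -[pi *+ 2]mulr_natl subrK.
by rewrite cosKN ?opprB//; lra.
Qed.

Lemma acos_cos_le a : 0 <= a <= 2 * pi ->
  acos (cos a) <= a /\ acos (cos a) <= 2 * pi - a.
Proof.
move=> /andP[a0 a2]; have [api|api] := leP a pi.
  by rewrite cosK ?in_itv/= ?a0//; lra.
by rewrite acos_cos_reflect; lra.
Qed.

Lemma acos_cos_ge a u : 0 <= u -> u <= a <= 2 * pi - u -> u <= acos (cos a).
Proof.
move=> u0 /andP[a0 a2]; have [api|api] := leP a pi.
  by rewrite cosK ?in_itv/= ?(le_trans u0).
by rewrite acos_cos_reflect; lra.
Qed.

Lemma mdist_circle_point_le a b :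
  mdist (circle_point a) (circle_point b) <= `|a - b|.
Proof.
rewrite mdist_circle_point -cos_norm; have [api|api] := leP `|a - b| pi.
  by rewrite cosK ?in_itv/= ?api ?normr_ge0.
by apply: le_trans (ltW api); rewrite acos_lepi// cos_geN1 cos_le1.
Qed.

End CirclePoint.

(** * The correspondence between the circle and the sphere *)

Section UpperBound.
Context {R : realType} (n : nat) (hn : (1 <= n)%N).

Let N : R := 2 * n%:R + 1.
Let u : R := pi / N.

Let N3 : 3 <= N.
Proof. by have : 1 <= n%:R :> R by [rewrite ler1n]; rewrite /N; lra. Qed.

Let NE : (2 * n).+1%:R = N.
Proof. by rewrite -natr1 natrM. Qed.

Let uN : u * N = pi.
Proof. by rewrite /u divfK//; have := N3; lra. Qed.

Let u_gt0 : 0 < u.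
Proof. by rewrite divr_gt0 ?pi_gt0//; have := N3; lra. Qed.

Let u3 : 3 * u <= pi.
Proof. by rewrite -uN mulrC ler_wpM2l// ltW. Qed.

(* The cell around [x] is sent to the [i]-th vertex of a regular [2n + 1]-gon,
   except that its centre covers the arc of length [pi / (2n + 1)] around it. *)
Definition half_corr (q : sphere R 1) (x : sphere R (2 * n)) : Prop :=
  exists i s, [/\ cell i (sphere_val x), `|s| <= u / 2,
    s = 0 \/ x = sphere_basis i & q = circle_point (2 * i%:R * u + s)].

(** For unit vectors, [cell_antipodal_bound] says that the inner product is at least
    [- n / (n + 1)]. *)
Lemma cell_diameter i (x y : sphere R (2 * n)) :
  cell i (sphere_val x) -> cell i (sphere_val y) -> mdist x y <= pi - u.
Proof.
move=> xi yi; have := cell_antipodal_bound xi yi; rewrite NE.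
have := inner_comb 1 1 (sphere_val x) (sphere_val y).
have := inner_comb 1 (-1) (sphere_val x) (sphere_val y).
rewrite !scale1r scaleN1r => -> ->; rewrite !sphere_inner1 => h.
have u0 := u_gt0; have pi3 := u3.
rewrite mdist_sphere_le; last by lra.
rewrite -[pi - u]opprB cosN cosB cospi sinpi mulr0 addr0 mulrN1.
have := cos_pi_odd_ge R hn; rewrite -/N -/u ler_pdivrMr; last by rewrite ltr_wpDl.
move: h; rewrite /N; have n0 : 0 <= n%:R :> R by [].
set c := inner _ _; move: (n%:R : R) n0 => m m0 h1 h2.
have h3 : - m <= c * (m + 1) by lra.
rewrite -(ler_pM2r (_ : 0 < m + 1)); last lra.
lra.
Qed.

(** In the [j]-th cell the [i]-th coordinate is not the larger of two coordinates whose squares sum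
    to at most 1. *)
Lemma center_far_from_cell i j (y : sphere R (2 * n)) : i != j ->
  cell j (sphere_val y) -> pi / 4 <= mdist (sphere_basis i) y.
Proof.
move=> ij [_ yj]; have pi0 := @pi_gt0 R.
rewrite mdist_sphere_ge; last by lra.
have -> : inner (sphere_val (sphere_basis i : sphere R (2 * n))) (sphere_val y) =
    sphere_val y 0 i.
  rewrite /inner (bigD1 i)//= big1 ?addr0 => [|l /negbTE li]; rewrite mxE eqxx/=.
    by rewrite eqxx mul1r.
  by rewrite li mul0r.
have c2 : 2 * cos (pi / 4) ^+ 2 = 1 :> R.
  have := @cos_pihalf R; rewrite (_ : pi / 2 = 2 * (pi / 4)); last by field.
  by rewrite mulr_natl cos_mulr2n -mulr_natl; lra.
have c0 : 0 <= cos (pi / 4) :> R by apply: cos_ge0_pihalf; lra.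
have : sphere_val y 0 i ^+ 2 + sphere_val y 0 j ^+ 2 <= 1.
  rewrite -(eqP (sphereP y)) (bigD1 i)//= (bigD1 j) 1?eq_sym//= lerD2l lerDl.
  by apply: sumr_ge0 => l _; exact: sqr_ge0.
by have := yj i; nra.
Qed.

Lemma center_distance i j : i != j ->
  mdist (sphere_basis i : sphere R (2 * n)) (sphere_basis j) = pi / 2.
Proof.
move=> ij; rewrite mdist_sphereE big1 ?acos0// => l _; rewrite !mxE eqxx/=.
by have [->|_] := eqVneq l i; rewrite ?(negbTE ij) ?mulr0 ?mul0r.
Qed.

Lemma center_cell i : cell i (sphere_val (sphere_basis i : sphere R (2 * n))).
Proof.
split; first by apply: sumr_ge0 => j _; rewrite mxE.
by move=> j; rewrite !mxE !eqxx/= lern1 leq_b1.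
Qed.

(** A nonzero offset on the circle forces the point of the sphere to be a cell centre, far enough
    from the other cells to compensate for it. *)
Lemma half_corr_offset i j (s r : R) (x y : sphere R (2 * n)) : i != j ->
  cell i (sphere_val x) -> cell j (sphere_val y) ->
  `|s| <= u / 2 -> `|r| <= u / 2 ->
  s = 0 \/ x = sphere_basis i -> r = 0 \/ y = sphere_basis j ->
  `|s| + `|r| <= mdist x y.
Proof.
move=> ij xi yj su ru; have u0 := u_gt0; have pi3 := u3.
move=> [->|xE] [->|yE].
- by rewrite normr0 addr0 mdist_ge0.
- rewrite normr0 add0r yE metric_sym.
  by apply: le_trans (center_far_from_cell _ xi); rewrite 1?eq_sym//; lra.
- rewrite normr0 addr0 xE.
  by apply: le_trans (center_far_from_cell ij yj); lra.
- by rewrite xE yE center_distance//; lra.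
Qed.

(** As the number of vertices is odd, the shorter arc between two of them has at most [n] sides, of
    length [2 * n%:R * u = pi - u]. *)
Lemma polygon_distance (i j : 'I_(2 * n).+1) (s r : R) : (i < j)%N ->
  `|s| <= u / 2 -> `|r| <= u / 2 ->
  u <= mdist (circle_point (2 * i%:R * u + s)) (circle_point (2 * j%:R * u + r))
    <= pi - u + (`|s| + `|r|).
Proof.
move=> ij su ru; have u0 := u_gt0; have pi3 := u3.
have jn : j%:R <= 2 * n%:R :> R by rewrite -natrM ler_nat -ltnS.
have i0 : 0 <= i%:R :> R by [].
have ij1 : i%:R + 1 <= j%:R :> R by rewrite natr1 ler_nat.
rewrite metric_sym mdist_circle_point.
set a := _ - _; pose d : R := j%:R - i%:R.
have aE : a = 2 * (d * u) + (r - s) by rewrite /a /d; ring.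
have [s1 r1] : - `|s| <= s <= `|s| /\ - `|r| <= r <= `|r|.
  by rewrite -!ler_norml !lexx.
have du : u <= d * u <= 2 * n%:R * u.
  by rewrite ler_peMl ?ler_wpM2r ?(ltW u0)//= /d; lra.
have piE : pi = 2 * n%:R * u + u by rewrite -uN /N; ring.
have a_ge0 : 0 <= a <= 2 * pi by rewrite aE; lra.
apply/andP; split; first by apply: acos_cos_ge; [exact: ltW|rewrite aE; lra].
have [ac1 ac2] := acos_cos_le a_ge0.
have [ijn|nij] := leqP (j - i) n.
  have dn : d <= n%:R by rewrite /d -natrB ?ler_nat// ltnW.
  have dnu : d * u <= n%:R * u by rewrite ler_wpM2r// ltW.
  by apply: le_trans ac1 _; rewrite aE; lra.
have dn : n%:R + 1 <= d by rewrite /d -natrB ?(ltnW ij)// natr1 ler_nat.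
have dnu : (n%:R + 1) * u <= d * u by rewrite ler_wpM2r// ltW.
by apply: le_trans ac2 _; rewrite aE; lra.
Qed.

(** In one cell both distances lie in [[0, pi - u]]. In two cells the circle distance lies between
    [u] and [pi - u] plus the offsets, the sphere distance between the offsets and [pi]. *)
Lemma half_corr_distortion q r x y : half_corr q x -> half_corr r y ->
  `|mdist q r - mdist x y| <= pi - u.
Proof.
move=> [i [s [xi su xs ->]]] [j [t [yj tu yt ->]]].
have u0 := u_gt0; have pi3 := u3.
have xy0 := mdist_ge0 x y.
have xypi : mdist x y <= pi by apply: acos_lepi; exact: sphere_inner_bound.
have st : `|s - t| <= `|s| + `|t| by exact: ler_normB.
have [ij|ij] := eqVneq i j.
  rewrite -ij in yj *; have := cell_diameter xi yj.
  have := mdist_circle_point_le (2 * i%:R * u + s) (2 * i%:R * u + t).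
  rewrite (_ : _ - _ = s - t); last by ring.
  set z := mdist (circle_point _) _; have : 0 <= z by exact: mdist_ge0.
  by rewrite ler_norml => *; lra.
have xyst := half_corr_offset ij xi yj su tu xs yt.
suff : u <= mdist (circle_point (2 * i%:R * u + s)) (circle_point (2 * j%:R * u + t))
    <= pi - u + (`|s| + `|t|).
  by rewrite ler_norml => /andP[h1 h2]; lra.
move: ij; rewrite neq_ltn => /orP[ij|ji]; first exact: polygon_distance.
by rewrite metric_sym (addrC `|s|); exact: polygon_distance.
Qed.

Definition sphere_corr (q : sphere R 1) (x : sphere R (2 * n)) : Prop :=
  half_corr q x \/ half_corr (sphere_opp q) (sphere_opp x).

Lemma sphere_corr_opp q x : sphere_corr (sphere_opp q) (sphere_opp x) ->
  sphere_corr q x.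
Proof. by rewrite /sphere_corr !sphere_oppK => -[]; [right|left]. Qed.

Lemma sphere_corr_distortion q r x y : sphere_corr q x -> sphere_corr r y ->
  `|mdist q r - mdist x y| <= pi - u.
Proof.
move=> [qx|qx] [ry|ry]; have := half_corr_distortion qx ry => //.
- rewrite !mdist_oppr distrC; congr (`|_| <= _); ring.
- rewrite !mdist_oppl distrC; congr (`|_| <= _); ring.
- by rewrite !mdist_opp.
Qed.

Lemma sphere_corr_right x : exists q, sphere_corr q x.
Proof.
have h (y : sphere R (2 * n)) : 0 <= \sum_j sphere_val y 0 j -> exists q, half_corr q y.
  move=> y0; have [i _ imax] := @arg_maxP _ _ _ ord0 xpredT (fun i => sphere_val y 0 i) isT.
  exists (circle_point (2 * i%:R * u + 0)), i, 0; split => //.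
  - by split => // j; exact: imax.
  - by rewrite normr0 divr_ge0// ltW// u_gt0.
  - by left.
have [/h[q qx]|x0] := leP 0 (\sum_j sphere_val x 0 j); first by exists q; left.
have [|q qx] := h (sphere_opp x).
  by under eq_bigr do rewrite mxE; rewrite sumrN oppr_ge0 ltW.
by exists (sphere_opp q); right; rewrite sphere_oppK.
Qed.

Lemma sphere_corr_left q : exists x, sphere_corr q x.
Proof.
suff h t : 0 <= t <= pi -> exists x, sphere_corr (circle_point t) x.
  have := circle_point_half_angle q; have /h[x tx] := half_angle_bound q.
  case: upper => ->; first by exists x.
  by exists (sphere_opp x); apply: sphere_corr_opp; rewrite !sphere_oppK.
move=> /andP[t0 tpi]; have u0 := u_gt0; have pi3 := u3.
have center i (s : R) : `|s| <= u / 2 ->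
    half_corr (circle_point (2 * (i : 'I__)%:R * u + s)) (sphere_basis i).
  by move=> su; exists i, s; split => //; [exact: center_cell|right].
have tu0 : 0 <= t / u + 2^-1 by rewrite addr_ge0// divr_ge0// ltW.
(* [l] is the integer nearest to [t / u]. Even multiples of [u] are vertices of the polygon, odd
   ones are antipodes of vertices. *)
have /andP[] := truncn_itv tu0; set l := Num.truncn _; rewrite -[l.+1%:R]natr1 => lt tl.
have tE : t = t / u * u by rewrite divfK// gt_eqF.
set v := t / u in lt tl tE.
have sP : `|t - l%:R * u| <= u / 2.
  rewrite tE -mulrBl normrM (gtr0_norm u0) mulrC ler_wpM2l ?(ltW u0)//.
  by rewrite ler_norml; lra.
have vN : v <= N by rewrite /v ler_pdivrMr// mulrC uN.
have lN : (l <= (2 * n).+1)%N.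
  by rewrite -ltnS -(ltr_nat R) -natr1 NE; lra.
have [lodd|leven] := boolP (odd l); last first.
  have lE : l = (2 * l./2)%N by rewrite mul2n -[LHS]odd_double_half (negbTE leven).
  have ln : (l./2 < (2 * n).+1)%N by lia.
  exists (sphere_basis (Ordinal ln)); left.
  have := center (Ordinal ln) _ sP; rewrite /= -natrM -lE.
  by rewrite addrC subrK.
(* Near the angle [pi] the vertex is the antipode of the 0-th one, whereas the index
   [(l + (2 * n).+1)./2] used below would be out of range. *)
have [lNE|lNlt] := eqVneq l (2 * n).+1.
  exists (sphere_opp (sphere_basis ord0)); apply: sphere_corr_opp.
  rewrite sphere_oppK; left; have := center ord0 _ sP.
  rewrite mulr0 mul0r add0r lNE NE mulrC uN -[X in sphere_opp (circle_point X)](subrK pi).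
  by rewrite circle_pointDpi sphere_oppK.
have lE : (2 * (l + (2 * n).+1)./2 = l + (2 * n).+1)%N by lia.
have ln : ((l + (2 * n).+1)./2 < (2 * n).+1)%N by lia.
exists (sphere_opp (sphere_basis (Ordinal ln))); apply: sphere_corr_opp.
rewrite sphere_oppK; left; have := center (Ordinal ln) _ sP.
rewrite /= -natrM lE natrD NE mulrDl [N * u]mulrC uN -circle_pointDpi.
by congr (half_corr (circle_point _) _); ring.
Qed.

Lemma sphere_gromov_hausdorff_le :
  (gromov_hausdorff (sphere R 1) (sphere R (2 * n)) <= (pi * n%:R / N)%:E)%E.
Proof.
have N0 := N3.
have r0 : 0 < pi * n%:R / N by rewrite divr_gt0 ?mulr_gt0 ?pi_gt0 ?ltr0n//; lra.
have rE : pi - u = 2 * (pi * n%:R / N).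
  by rewrite /u /N; field; rewrite -/N; lra.
apply: gromov_hausdorff_le.
apply: (@Correspondence R _ _ _ sphere_corr) => //.
- have [x qx] := sphere_corr_left (circle_point 0).
  by exists (circle_point 0), x.
- exact: sphere_corr_left.
- exact: sphere_corr_right.
- by move=> q r x y qx ry; rewrite -rE; exact: sphere_corr_distortion.
Qed.

End UpperBound.

Theorem theorem1p3 (R : realType) (n : nat) (hn : (1 <= n)%N) :
  gromov_hausdorff (sphere R 1) (sphere R (2 * n)) =
  (pi * n%:R / (2 * n%:R + 1))%:E.
Proof.
apply/le_anti/andP; split; first exact: sphere_gromov_hausdorff_le.
apply: gromov_hausdorff_ge => h D /distortion_lower_bound.
have n0 : 0 < 2 * n%:R + 1 :> R by rewrite ltr_pwDr// mulr_ge0.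
rewrite mulrA ler_pdivrMr//; lra.
Qed.
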